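(* There exists a functor $K^*_{\mathbf{mbC}}:\mathbf{BAlg}\to\mathbf{SW}_{\mathbf{mbC}}$ given by $K^*_{\mathbf{mbC}}(\mathcal{A})=\mathcal{B}_{\mathcal{A}}^{\mathbf{mbC}}$ for every Boolean algebra $\mathcal{A}$, and $K^*_{\mathbf{mbC}}(f)=f_\ast$ for every homomorphism $f:\mathcal{A}\to\mathcal{A}'$ of Boolean algebras, where $f_\ast(z_1,z_2,z_3)=(f(z_1),f(z_2),f(z_3))$.
   Context: Let $\Sigma=\{\wedge,\vee,\to,\neg,\circ\}$, with $\wedge,\vee,\to$ binary and $\neg,\circ$ unary. A multialgebra over $\Sigma$ is a nonempty set $B$ with, for each $n$-ary symbol $c$, a function $c^{\mathcal{B}}:B^n\to\wp(B)\setminus\{\emptyset\}$. A homomorphism $f:\mathcal{A}\to\mathcal{B}$ is a function between the domains with $f[c^{\mathcal{A}}(\vec a)]\subseteq c^{\mathcal{B}}(f(\vec a))$ for all $c$ and $\vec a$. These form the category $\mathbf{MAlg}(\Sigma)$. $\mathbf{BAlg}$ is the category of Boolean algebras and Boolean homomorphisms (the one-element Boolean algebra is allowed). For a Boolean algebra $\mathcal{A}$ with domain $A$ and $z\in A^3$ write $z=(z_1,z_2,z_3)$. Put $\mathrm{B}_{\mathcal{A}}^{\mathbf{mbC}}=\{z\in A^3 : z_1\vee z_2=1 \text{ and } z_1\wedge z_2\wedge z_3=0\}$. A swap structure for $\mathbf{mbC}$ over $\mathcal{A}$ is a multialgebra $\mathcal{B}$ over $\Sigma$ with domain $B\subseteq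 \mathrm{B}_{\mathcal{A}}^{\mathbf{mbC}}$ such that $0\in\{z_1: z\in B\}$ and for all $z,w\in B$: (i) $\emptyset\ne z\#w\subseteq\{u\in B: u_1=z_1\# w_1\}$ for $\#\in\{\wedge,\vee,\to\}$; (ii) $\emptyset\neq\neg z\subseteq\{u\in B:u_1=z_2\}$; (iii) $\emptyset\ne\circ z\subseteq\{u\in B:u_1=z_3\}$. The full swap structure $\mathcal{B}_{\mathcal{A}}^{\mathbf{mbC}}$ has domain $\mathrm{B}_{\mathcal{A}}^{\mathbf{mbC}}$ and equality in the right-hand inclusions of (i)–(iii). $\mathbf{SW}_{\mathbf{mbC}}$ is the full subcategory of $\mathbf{MAlg}(\Sigma)$ whose objects are the swap structures for $\mathbf{mbC}$ (over arbitrary Boolean algebras). *)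

(* Defs.v *)
From HB Require Import structures.
From mathcomp Require Import all_boot all_order.
From mathcomp Require Import boolp classical_sets.
Set Implicit Arguments.
Unset Strict Implicit.
Unset Printing Implicit Defensive.
Import Order.Theory.
Local Open Scope order_scope.

Record category := Category {
  ob :> Type;
  hom : ob -> ob -> Type;
  idm : forall X, hom X X;
  comp : forall X Y Z, hom Y Z -> hom X Y -> hom X Z;
  comp1m : forall X Y (f : hom X Y), comp (idm Y) f = f;
  compm1 : forall X Y (f : hom X Y), comp f (idm X) = f;
  compA : forall X Y Z W (h : hom Z W) (g : hom Y Z) (f : hom X Y),
    comp h (comp g f) = comp (comp h g) f
}.
Arguments hom {c} X Y.
Arguments idm {c} X.
Arguments comp {c X Y Z} g f.

Record functor (C D : category) := Functor {
  fobj :> C -> D;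
  fmap : forall X Y : C, hom X Y -> hom (fobj X) (fobj Y);
  fmap1 : forall X, fmap (idm X) = idm (fobj X);
  fmapM : forall X Y Z (g : hom Y Z) (f : hom X Y),
    fmap (comp g f) = comp (fmap g) (fmap f)
}.
Arguments fmap {C D} F {X Y} f : rename.

Definition full_subcategory (C : category) (P : C -> Prop) : category :=
  @Category {X : C | P X} (fun X Y => hom (sval X) (sval Y))
    (fun X => idm (sval X)) (fun X Y Z g f => comp g f)
    (fun X Y f => comp1m f) (fun X Y f => compm1 f)
    (fun X Y Z W h g f => compA h g f).

(* The identity morphism of [X = Y], regarded as a morphism from X to Y. *)
Definition eq_hom (C : category) (X Y : C) (e : X = Y) : hom X Y :=
  match e in _ = Z return hom X Z with erefl => idm X end.

(* The display is only a notational tag. [ctbDistrLatticeType] does not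
   require \bot != \top, so the one-element algebra is an object; its
   choiceType structure is available on any type by classical choice. *)
Record boolAlg := BoolAlg {
  ba_disp : Order.disp_t;
  ba_sort :> ctbDistrLatticeType ba_disp
}.

Record boolHom (A B : boolAlg) := BoolHom {
  bh_fun :> A -> B;
  bh_meet : {morph bh_fun : x y / x `&` y};
  bh_join : {morph bh_fun : x y / x `|` y};
  bh_compl : {morph bh_fun : x / ~` x};
  bh_bot : bh_fun \bot = \bot;
  bh_top : bh_fun \top = \top
}.

Lemma boolHom_eq (A B : boolAlg) (f g : boolHom A B) : f =1 g -> f = g.
Proof.
case: f g => [f f1 f2 f3 f4 f5] [g g1 g2 g3 g4 g5] /= /funext fg.
by subst g; congr BoolHom; apply: Prop_irrelevance.
Qed.

Definition boolHom_id (A : boolAlg) : boolHom A A.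
Proof. by exists id. Defined.

Definition boolHom_comp (A B C : boolAlg) (g : boolHom B C) (f : boolHom A B) :
  boolHom A C.
Proof.
exists (g \o f) => [x y|x y|x||] /=; rewrite ?bh_meet ?bh_join ?bh_compl //.
- by rewrite !bh_bot.
- by rewrite !bh_top.
Defined.

Definition BAlg : category.
Proof.
by refine (@Category boolAlg boolHom boolHom_id boolHom_comp _ _ _) => *;
  apply: boolHom_eq.
Defined.

Inductive connective := And | Or | Imp | Neg | Circ.

Definition arity (c : connective) : nat :=
  match c with And | Or | Imp => 2 | Neg | Circ => 1 end.

Record multialgebra_on (B : Type) := MultialgebraOn {
  mop :> forall c, (arity c).-tuple B -> set B;
  mop_neq0 : forall c (a : (arity c).-tuple B), exists u, mop a u;
  dom_neq0 : inhabited B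
}.
Arguments mop {B} m c a.

Record multialgebra := Multialgebra {
  dom :> Type;
  mops : multialgebra_on dom
}.

Record malgHom (M N : multialgebra) := MalgHom {
  mh_fun :> M -> N;
  mh_sub : forall c (a : (arity c).-tuple M),
    (mh_fun @` mops M c a `<=` mops N c (map_tuple mh_fun a))%classic
}.

Lemma malgHom_eq (M N : multialgebra) (f g : malgHom M N) : f =1 g -> f = g.
Proof.
case: f g => [f f1] [g g1] /= /funext fg.
by subst g; congr MalgHom; apply: Prop_irrelevance.
Qed.

Definition malgHom_id (M : multialgebra) : malgHom M M.
Proof.
exists id => c a _ [u au <-].
by have -> : map_tuple id a = a by apply: val_inj; rewrite /= map_id.
Defined.

Definition malgHom_comp (M N P : multialgebra) (g : malgHom N P)
  (f : malgHom M N) : malgHom M P.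
Proof.
exists (g \o f) => c a _ [u au <-].
have -> : map_tuple (g \o f) a = map_tuple g (map_tuple f a).
  by apply: val_inj; rewrite /= map_comp.
by apply: mh_sub; exists (f u) => //; apply: mh_sub; exists u.
Defined.

Definition MAlg : category.
Proof.
by refine (@Category multialgebra malgHom malgHom_id malgHom_comp _ _ _) => *;
  apply: malgHom_eq.
Defined.

Definition triple (T : Type) : Type := (T * T * T)%type.
Definition pr1 (T : Type) (z : triple T) : T := z.1.1.
Definition pr2 (T : Type) (z : triple T) : T := z.1.2.
Definition pr3 (T : Type) (z : triple T) : T := z.2.

Definition map_triple (T U : Type) (f : T -> U) (z : triple T) : triple U :=
  (f (pr1 z), f (pr2 z), f (pr3 z)).

Section Swap.
Variable A : boolAlg.

Definition BmbC : set (triple A) :=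
  [set z | (pr1 z `|` pr2 z = \top)%O /\
           (pr1 z `&` pr2 z `&` pr3 z = \bot)%O]%classic.

(* The first coordinate prescribed by clauses (i)-(iii) for the members of
   c(a); the implication of a Boolean algebra is x -> y := ~x \/ y. *)
Definition first_coord (c : connective) :
    (arity c).-tuple (triple A) -> A :=
  match c with
  | And => fun a => pr1 (tnth a ord0) `&` pr1 (tnth a ord_max)
  | Or => fun a => pr1 (tnth a ord0) `|` pr1 (tnth a ord_max)
  | Imp => fun a => ~` pr1 (tnth a ord0) `|` pr1 (tnth a ord_max)
  | Neg => fun a => pr2 (tnth a ord0)
  | Circ => fun a => pr3 (tnth a ord0)
  end.

(* Nonemptiness of the values is part of [multialgebra_on]. *)
Record is_swap (B : set (triple A)) (M : multialgebra_on B) : Prop := IsSwap {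
  swap_dom : (B `<=` BmbC)%classic;
  swap_bot : [set pr1 z | z in B]%classic \bot;
  swap_op : forall c (a : (arity c).-tuple B),
    (M c a `<=` [set u : B | pr1 (val u) = first_coord (map_tuple val a)])%classic
}.

Definition full_op c (a : (arity c).-tuple BmbC) : set BmbC :=
  [set u : BmbC | pr1 (val u) = first_coord (map_tuple val a)]%classic.

Lemma BmbC_fiber (x : A) : exists u : BmbC, pr1 (val u) = x.
Proof.
have xB : (x, ~` x, \top) \in BmbC.
  by rewrite inE; split; rewrite /pr1 /pr2 /pr3 /= ?joinxC // meetxC meet0x.
by exists (SigSub xB).
Qed.

Definition full_swap_ops : multialgebra_on BmbC.
Proof.
exists full_op => [c a|]; first exact: BmbC_fiber.
by have [u _] := BmbC_fiber \bot.
Defined.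

End Swap.

Definition full_swap (A : boolAlg) : multialgebra :=
  Multialgebra (full_swap_ops A).

Definition SWmbC : category :=
  full_subcategory (C := MAlg) (fun M : multialgebra =>
    exists (A : boolAlg) (B : set (triple A)) (S : multialgebra_on B),
      is_swap S /\ M = Multialgebra S).

Definition coords (A : boolAlg) (z : full_swap A) : triple A :=
  val (z : set_type (@BmbC A)).

(* Main.v *)
Require Import Defs.
From mathcomp Require Import all_boot all_order.
From mathcomp Require Import boolp classical_sets.

(** Membership in [BmbC] is given by Boolean equations, so a Boolean homomorphism applied
    coordinatewise preserves it ([map_triple_BmbC]). A multioperation of the full swap structure
    constrains only the first coordinate, and does so by a Boolean term, which homomorphisms respect
    ([first_coord_map]); hence [fstar] is a morphism. Functoriality is then checked pointwise. *)

Lemma full_swapP (A : boolAlg) : is_swap (full_swap_ops A).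
Proof.
split=> [//||c a u //].
by have [u u1] := BmbC_fiber (\bot%O : A); exists (val u) => //; apply: set_valP.
Qed.

Section FStar.
Context {A A' : boolAlg} (f : boolHom A A').

Lemma map_triple_BmbC (z : triple A) : BmbC z -> BmbC (map_triple f z).
Proof.
by case=> z12 z123; split; rewrite /pr1 /pr2 /pr3 /= -?bh_join -?bh_meet;
  [rewrite z12 bh_top | rewrite z123 bh_bot].
Qed.

Definition fstar_fun (z : full_swap A) : full_swap A' :=
  SigSub (mem_set (map_triple_BmbC _ (set_valP z))).

Lemma first_coord_map c (a : (arity c).-tuple (triple A)) :
  first_coord (map_tuple (map_triple f) a) = f (first_coord a).
Proof.
by case: c a => a /=; rewrite !tnth_map /= ?bh_meet ?bh_join ?bh_compl.
Qed.

Definition fstar : malgHom (full_swap A) (full_swap A').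
Proof.
exists fstar_fun => c a _ [u /= au <-].
(* The first coordinate of the image of [u] is [f] of that of [u], which [au] prescribes. *)
rewrite /full_op /= -[LHS]/(f (pr1 (val u))) au -first_coord_map.
by congr first_coord; apply: val_inj; rewrite /= -!map_comp.
Defined.

End FStar.

Definition Kstar : functor BAlg SWmbC.
Proof.
unshelve refine (@Functor BAlg SWmbC
  (fun A : boolAlg => exist _ (full_swap A)
     (ex_intro _ A (ex_intro _ _ (ex_intro _ _ (conj (full_swapP A) erefl)))))
  (fun A A' f => fstar f) _ _).
- by move=> A; apply: malgHom_eq => z; apply: val_inj; case: z => -[[]].
- by move=> A B C g f; apply: malgHom_eq => z; apply: val_inj.
Defined.

Theorem corollary6p9 :
  exists (K : functor BAlg SWmbC)
         (e : forall A : boolAlg, sval (K A) = full_swap A),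
    forall (A A' : boolAlg) (f : boolHom A A') (z : dom (sval (K A))),
      coords ((eq_hom (C := MAlg) (e A') : malgHom _ _)
                ((fmap K f : malgHom _ _) z))
      = map_triple f (coords ((eq_hom (C := MAlg) (e A) : malgHom _ _) z)).
(* [Kstar] is transparent, so its objects compute to [full_swap A] and both transports [eq_hom] are
   identities. *)
Proof. by exists Kstar, (fun=> erefl). Qed.
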